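(* For every semigroup $S$, any non-zero cardinal $\lambda$ and any positive integer $n\leqslant\lambda$ the following statements hold: (i) $\mathscr{I}_\lambda^n(S)$ is regular if and only if $S$ is regular; (ii) $\mathscr{I}_\lambda^n(S)$ is orthodox if and only if $S$ is orthodox; (iii) $\mathscr{I}_\lambda^n(S)$ is inverse if and only if $S$ is inverse.
   Context: A semigroup $T$ is regular if for every $a\in T$ there is $b\in T$ with $a=aba$; orthodox if it is regular and its set of idempotents $E(T)$ is a subsemigroup; inverse if for every $a\in T$ there is a unique $a^{-1}\in T$ with $aa^{-1}a=a$ and $a^{-1}aa^{-1}=a^{-1}$. $\mathscr{I}_\lambda^n$ is the semigroup of all partial injective maps $\lambda\rightharpoonup\lambda$ of rank (cardinality of the range) at most $n$, with composition $x(\alpha\beta)=(x\alpha)\beta$; its zero is the empty map. The semigroup $\mathscr{I}_\lambda^n(S)$ consists of all maps $\alpha_S\colon \mathrm{Gr}(\alpha)\to S$, where $\alpha\in\mathscr{I}_\lambda^n$ and $\mathrm{Gr}(\alpha)\subset\lambda\times\lambda$ is the graph of $\alpha$; the element with empty graph is denoted $0$. The product $\alpha_S\cdot\beta_S$ has as underlying partial map the composition $\alpha\beta$, and if $(a,b)\in\mathrm{Gr}(\alpha)$ is sent to $s$ by $\alpha_S$ and $(b,d)\in\mathrm{Gr}(\beta)$ is sent to $t$ by $\beta_S$, then $\alpha_S\cdot\beta_S$ sends $(a,d)$ to $st$; in particular the product is $0$ if $\alpha\beta$ is empty. *)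

(* Defs.v *)
From HB Require Import structures.
From mathcomp Require Import all_boot monoid.
From mathcomp Require Import boolp classical_sets functions cardinality.

Set Implicit Arguments.
Unset Strict Implicit.
Unset Printing Implicit Defensive.

Local Open Scope classical_set_scope.
Local Open Scope card_scope.
Local Open Scope group_scope.

Definition regular (T : semigroupType) : Prop :=
  forall a : T, exists b : T, a = a * b * a.

Definition idempotents (T : semigroupType) : set T := [set e | e * e = e].

Definition orthodox (T : semigroupType) : Prop :=
  regular T /\
  forall e f : T, idempotents e -> idempotents f -> idempotents (e * f).

Definition inverse_semigroup (T : semigroupType) : Prop :=
  forall a : T, exists! b : T, a * b * a = a /\ b * a * b = b.

Section PartialInjections.
Variables (lam : Type) (n : nat).

Definition prange (f : lam -> option lam) : set lam :=
  [set y | exists x, f x = Some y].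

Record pinj := PInj {
  pinj_fun :> lam -> option lam;
  pinj_inj : forall x y z,
    pinj_fun x = Some z -> pinj_fun y = Some z -> x = y;
  pinj_rank : prange pinj_fun #<= `I_n
}.

HB.instance Definition _ := gen_eqMixin pinj.
HB.instance Definition _ := gen_choiceMixin pinj.

Lemma pinj_ext (a b : pinj) : (forall x, a x = b x) -> a = b.
Proof.
case: a b => [f fi fr] [g gi gr] /= /funext fg; rewrite -{g}fg in gi gr *.
by rewrite (Prop_irrelevance fi gi) (Prop_irrelevance fr gr).
Qed.

(* Maps act on the right: x (a b) = (x a) b. *)
Definition pcomp (f g : lam -> option lam) (x : lam) : option lam :=
  obind g (f x).

Lemma pcompP f g x z :
  pcomp f g x = Some z -> {y | f x = Some y & g y = Some z}.
Proof. by rewrite /pcomp; case: (f x) => //= y gy; exists y. Qed.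

Lemma pcomp_inj (a b : pinj) x y z :
  pcomp a b x = Some z -> pcomp a b y = Some z -> x = y.
Proof.
move=> /pcompP[x' ax bx] /pcompP[y' ay bY].
by move: ay; rewrite -(pinj_inj bx bY); apply: pinj_inj.
Qed.

Lemma pcomp_rank (a b : pinj) : prange (pcomp a b) #<= `I_n.
Proof.
apply: card_le_trans (pinj_rank b); apply: subset_card_le.
by move=> z [x /pcompP[y _ byz]]; exists y.
Qed.

Definition pinj_mul (a b : pinj) : pinj :=
  PInj (@pcomp_inj a b) (pcomp_rank a b).

Lemma pinj_mulA : associative pinj_mul.
Proof. by move=> a b c; apply: pinj_ext => x /=; rewrite /pcomp; case: (a x). Qed.

HB.instance Definition _ := isSemigroup.Build pinj pinj_mulA.

Definition graph (a : pinj) : set (lam * lam) := [set p | a p.1 = Some p.2].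

Variable S : semigroupType.

Record spinj := SPInj {
  spinj_base : pinj;
  spinj_val : graph spinj_base -> S
}.

HB.instance Definition _ := gen_eqMixin spinj.
HB.instance Definition _ := gen_choiceMixin spinj.

Definition gpoint (a : pinj) x y (axy : a x = Some y) : graph a :=
  exist _ (x, y) (mem_set (axy : graph a (x, y))).

Lemma gpointP (a : pinj) (p : graph a) : a (val p).1 = Some (val p).2.
Proof. exact: set_mem (valP p). Qed.

(* A point (x, z) of the graph of a b factors through a unique y, with
   (x, y) in the graph of a and (y, z) in the graph of b. *)
Definition spinj_mul_val (u v : spinj)
    (p : graph (spinj_base u * spinj_base v)) : S :=
  let: exist2 y uy vy := pcompP (gpointP p) in
  spinj_val (gpoint uy) * spinj_val (gpoint vy).

Definition spinj_mul (u v : spinj) : spinj := SPInj (@spinj_mul_val u v).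

Lemma spinj_mulE (u v : spinj) x y z
    (uxy : spinj_base u x = Some y) (vyz : spinj_base v y = Some z)
    (uvxz : spinj_base (spinj_mul u v) x = Some z) :
  spinj_val (gpoint uvxz) = spinj_val (gpoint uxy) * spinj_val (gpoint vyz).
Proof.
rewrite /= /spinj_mul_val; case: pcompP => y' /= uxy' vyz'.
have yy' : y' = y by move: (uxy'); rewrite uxy => -[].
subst y'.
by rewrite (Prop_irrelevance uxy' uxy) (Prop_irrelevance vyz' vyz).
Qed.

Lemma spinj_ext (u v : spinj) :
    (forall x, spinj_base u x = spinj_base v x) ->
    (forall x y (uxy : spinj_base u x = Some y) (vxy : spinj_base v x = Some y),
       spinj_val (gpoint uxy) = spinj_val (gpoint vxy)) ->
  u = v.
Proof.
case: u v => [a f] [b g] /= /pinj_ext ab; case: b / ab g => g fg.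
congr SPInj; apply: funext => p.
have -> : p = gpoint (gpointP p) by apply: val_inj; rewrite /=; case: (val p).
exact: fg.
Qed.

Lemma spinj_mulA : associative spinj_mul.
Proof.
move=> u v w; apply: spinj_ext => [x|x t h1 h2].
  by rewrite /= /pcomp; case: (spinj_base u x).
have [y uxy h] := pcompP h1; have [z vyz wzt] := pcompP h.
have uvxz : spinj_base (spinj_mul u v) x = Some z by rewrite /= /pcomp uxy.
by rewrite (spinj_mulE uxy h) (spinj_mulE vyz wzt) (spinj_mulE uvxz wzt)
  (spinj_mulE uxy vyz) mulgA.
Qed.

HB.instance Definition _ := isSemigroup.Build spinj spinj_mulA.

End PartialInjections.

(* Main.v *)
Require Import Defs.
From mathcomp Require Import all_boot monoid.
From mathcomp Require Import boolp classical_sets functions cardinality.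

Local Open Scope classical_set_scope.
Local Open Scope card_scope.

(** An element [u] of the extension of [S] by partial injections is a set of
    arrows [x -> y] between points of [lam], each labelled by an element of
    [S], with at most one arrow leaving and at most one arrow entering every
    point, and with at most [n] arrows in all.  The product composes arrows
    and multiplies their labels ([arrowM]).

    Since arrows never branch, the equations that matter can be read off one
    arrow at a time.  In [u * b * u = u] a composite path that starts with
    [x -> y] can only go forth along this arrow, back along an arrow [y -> x]
    of [b], and forth again; so the equation says that each arrow of [u]
    labelled [s] is reversed by an arrow of [b] labelled by some [t] with
    [s * t * s = s] ([inner_inverseP]).  In the same way [u * u = u] says that
    all arrows of [u] are loops with idempotent labels ([idempotentP]).

    Regularity therefore passes from [S] to the extension by reversing all the
    arrows of [u] and replacing each label [s] by a chosen [t] with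
    [s * t * s = s] ([reverse_exists]); when [S] is inverse and [t] is the
    inverse of [s], this is the only inverse of [u].  Idempotents of the
    extension compose loop by loop, so their products are idempotent as soon
    as this holds for labels.

    The three properties pass back to [S] along the embedding that sends
    [s] to the single loop labelled [s] at a fixed point, an element of rank
    one, hence available as soon as [n] is positive ([loop_exists]). *)

Section Arrows.
Local Open Scope group_scope.
Context {lam : Type} {n : nat} {S : semigroupType}.
Implicit Types u v b : spinj lam n S.

(** * Elements as sets of labelled arrows *)

(** Stating the label as a relation hides the proofs of membership in the
    graph on which [spinj_val] depends. *)
Definition arrow u x y s : Prop :=
  exists h : spinj_base u x = Some y, spinj_val (gpoint h) = s.

Lemma arrow_fun {u x y y' s s'} :
  arrow u x y s -> arrow u x y' s' -> y' = y /\ s' = s.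
Proof.
move=> [h <-] [h' <-]; have yy' : y' = y by move: (h'); rewrite h => -[].
by subst y'; rewrite (Prop_irrelevance h' h).
Qed.

Lemma arrow_inj {u x x' y s s'} :
  arrow u x y s -> arrow u x' y s' -> x' = x /\ s' = s.
Proof.
move=> uxy; move: (uxy) => [h _] ux'y; move: (ux'y) => [h' _].
have xx' : x' = x := pinj_inj h' h.
by subst x'; split=> //; case: (arrow_fun uxy ux'y).
Qed.

Lemma arrow_ext u v :
  (forall x y s, arrow u x y s <-> arrow v x y s) -> u = v.
Proof.
move=> uv; apply: spinj_ext => [x|x y uxy vxy].
- case uE: (spinj_base u x) => [y|].
    have /uv[vxy _] : arrow u x y (spinj_val (gpoint uE)) by exists uE.
    by rewrite vxy.
  case vE: (spinj_base v x) => [y|] //.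
  have /uv[uxy _] : arrow v x y (spinj_val (gpoint vE)) by exists vE.
  by rewrite -uE uxy.
- have /uv[h <-] : arrow u x y (spinj_val (gpoint uxy)) by exists uxy.
  by rewrite (Prop_irrelevance h vxy).
Qed.

Lemma arrowM u v x z r :
  arrow (u * v) x z r <->
  exists y s t, [/\ arrow u x y s, arrow v y z t & r = s * t].
Proof.
split=> [[h <-]|[y [s [t [[hu <-] [hv <-] ->]]]]].
- have [y uxy vyz] := pcompP h.
  exists y, (spinj_val (gpoint uxy)), (spinj_val (gpoint vyz)).
  by split; [exists uxy|exists vyz|exact: spinj_mulE].
- have h : spinj_base (spinj_mul u v) x = Some z by rewrite /= /Defs.pcomp hu.
  by exists h; exact: spinj_mulE.
Qed.

Lemma arrowM_intro {u v x y z s t} :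
  arrow u x y s -> arrow v y z t -> arrow (u * v) x z (s * t).
Proof. by move=> uxy vyz; apply/arrowM; exists y, s, t. Qed.

(** This allows elements to be built without choosing targets and labels by
    hand: both are extracted here, once, from the mere existence of arrows. *)
Lemma spinj_of_arrows (A : lam -> lam -> S -> Prop) :
    (forall x y y' s s', A x y s -> A x y' s' -> y = y' /\ s = s') ->
    (forall x x' y s s', A x y s -> A x' y s' -> x = x') ->
    [set y | exists x s, A x y s] #<= `I_n ->
  exists u, forall x y s, arrow u x y s <-> A x y s.
Proof.
move=> Afun Ainj Ale.
pose f x := if pselect (exists y s, A x y s) is left e
            then Some (projT1 (cid e)) else None.
have fP x y : f x = Some y -> exists s, A x y s.
  by rewrite /f; case: pselect => // e [<-]; case: cid.
have fE x y s : A x y s -> f x = Some y.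
  rewrite /f => xy; case: pselect => [e|[]]; last by exists y, s.
  by case: cid => y' [s' /= xy']; have [-> _] := Afun _ _ _ _ _ xy xy'.
have finj x y z : f x = Some z -> f y = Some z -> x = y.
  by move=> /fP[s xz] /fP[t yz]; exact: Ainj xz yz.
have frank : prange f #<= `I_n.
  apply: card_le_trans Ale; apply: subset_card_le.
  by move=> y [x /fP[s xy]]; exists x, s.
pose a := PInj finj frank.
have aP (p : graph a) : exists s, A (val p).1 (val p).2 s.
  exact: fP (gpointP p).
exists (SPInj (fun p => projT1 (cid (aP p)))) => x y s; split.
- by move=> [h <-] /=; case: cid.
- move=> xy; exists (fE _ _ _ xy) => /=.
  by case: cid => t /= xy'; have [] := Afun _ _ _ _ _ xy xy'.
Qed.

(** * Equations read arrow by arrow *)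

Lemma inner_inverseP u b :
  u * b * u = u <->
  forall x y s, arrow u x y s -> exists t, arrow b y x t /\ s * t * s = s.
Proof.
split=> [ubu x y s uxy|ub].
- move: (uxy); rewrite -{1}ubu.
  move=> /arrowM[x1 [_ [s2 [/arrowM[y1 [s1 [t [uxy1 byx ->]]]] ux1y sE]]]].
  have [? ?] := arrow_fun uxy uxy1; have [? ?] := arrow_inj uxy ux1y.
  by subst y1 s1 x1 s2; exists t.
- apply: arrow_ext => x y r; split=> [|uxy].
    move=> /arrowM[x1 [_ [s2 [/arrowM[y1 [s [t [uxy byx1 ->]]]] ux1y ->]]]].
    have [t' [byx sts]] := ub _ _ _ uxy; have [? ?] := arrow_fun byx byx1.
    by subst; have [? ?] := arrow_fun uxy ux1y; subst; rewrite sts.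
  have [t [byx <-]] := ub _ _ _ uxy.
  exact: arrowM_intro (arrowM_intro uxy byx) uxy.
Qed.

Lemma idempotentP u :
  idempotents u <->
  forall x y s, arrow u x y s -> x = y /\ idempotents s.
Proof.
split=> [uu x y s uxy|ul].
- move: (uxy); rewrite -{1}uu => /arrowM[z [s1 [s2 [uxz uzy sE]]]].
  have [? ?] := arrow_fun uxy uxz; have [? ?] := arrow_inj uxy uzy.
  by subst z s1 s2.
- apply: arrow_ext => x y r; split=> [/arrowM[z [s [t [uxz uzy ->]]]]|uxy].
    have [? ss] := ul _ _ _ uxz; subst z.
    by have [? ?] := arrow_fun uxz uzy; subst; rewrite ss.
  have [? rr] := ul _ _ _ uxy; subst y.
  by rewrite -rr; exact: (arrowM_intro uxy uxy).
Qed.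

(** * Reversing arrows *)

(** The reversed element has the right rank because a partial injection has
    as many points in its domain as in its range. *)
Lemma reverse_exists (g : S -> S) u :
  exists b, forall y x t,
    arrow b y x t <-> exists s, arrow u x y s /\ t = g s.
Proof.
apply: spinj_of_arrows => [y x x' _ _ [s [uxy ->]] [s' [ux'y ->]]
                          |y y' x _ _ [s [uxy _]] [s' [uxy' _]]|].
- by have [-> ->] := arrow_inj uxy ux'y.
- by have [->] := arrow_fun uxy uxy'.
set D := [set x | _]; pose f := spinj_base u.
have DP x : D x <-> exists y, f x = Some y.
  split=> [[y [_ [s [[h _] _]]]]|[y h]]; first by exists y.
  by exists y, (g (spinj_val (gpoint h))), (spinj_val (gpoint h)); split=> //;
    exists h.
have finj : {in D &, injective f}.
  move=> x x' /set_mem/DP[y xy] _ xx'; apply: (pinj_inj xy).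
  by rewrite -[RHS]xy xx'.
(* The map [f] is injective on its domain [D] and takes its values in
   [option lam], where they form a copy of the range. *)
have fD : f @` D = Some @` prange f.
  apply/seteqP; split=> [_ [x /DP[y xy] <-]|_ [y [x xy] <-]].
    by exists y => //; exists x.
  by exists x => //; apply/DP; exists y.
have Some_inj : {in prange f &, injective Some} by move=> y y' _ _ [].
rewrite -(card_le_eql (inj_card_eq finj)) fD.
rewrite (card_le_eql (inj_card_eq Some_inj)).
exact: pinj_rank.
Qed.

(** * Loops at a point *)

Lemma loop_exists (x : lam) : (0 < n)%N ->
  exists e : S -> spinj lam n S, forall s a c t,
    arrow (e s) a c t <-> [/\ a = x, c = x & t = s].
Proof.
move=> n_gt0; suff /choice[e eE] : forall s, exists u : spinj lam n S,
  forall a c t, arrow u a c t <-> [/\ a = x, c = x & t = s] by exists e.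
move=> s; apply: spinj_of_arrows => [a c c' t t' [_ -> ->] [_ -> ->]
                          |a a' c t t' [-> _ _] [-> _ _]|] //.
apply: (@card_le_trans _ _ _ [set x]).
  by apply: subset_card_le => c [a [t [_ -> _]]].
by rewrite (card_le_eql card_set1) card_le_II.
Qed.

End Arrows.

(** * Transfer between the semigroup and its extension *)

Section Transfer.
Local Open Scope group_scope.
Context {lam : Type} {n : nat} {S : semigroupType}.

Lemma regular_extension : regular S -> regular (spinj lam n S).
Proof.
move=> /choice[g gP] u; have [b bE] := reverse_exists g u.
exists b; apply/esym/inner_inverseP => x y s uxy.
by exists (g s); split; [apply/bE; exists s|rewrite -gP].
Qed.

Lemma orthodox_extension : orthodox S -> orthodox (spinj lam n S).
Proof.
move=> [Sreg Sidem]; split; first exact: regular_extension.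
move=> u v /idempotentP uu /idempotentP vv; apply/idempotentP => x z r.
move=> /arrowM[y [s [t [/uu[-> ss] /vv[-> tt] ->]]]].
by split=> //; exact: Sidem.
Qed.

(** An inverse of [u] has exactly the reversed arrows of [u], and the label of
    each is an inverse of the original one; it is thus unique when inverses
    in [S] are. *)
Lemma inverse_extension :
  inverse_semigroup S -> inverse_semigroup (spinj lam n S).
Proof.
move=> Sinv; have [g gP] := choice Sinv.
move=> u; have [b bE] := reverse_exists g u.
exists b; split=> [|c [/inner_inverseP uc /inner_inverseP cu]].
  split; apply/inner_inverseP.
  - move=> x y s uxy; exists (g s); have [[sgs _] _] := gP s.
    by split=> //; apply/bE; exists s.
  - by move=> y x _ /bE[s [uxy ->]]; exists s; have [[_ gsg] _] := gP s.
apply: arrow_ext => y x t; split=> [/bE[s [uxy {t}->]]|cyx].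
- have [t [cyx sts]] := uc _ _ _ uxy; have [s' [uxy' tst]] := cu _ _ _ cyx.
  have [_ ?] := arrow_fun uxy uxy'; subst s'.
  by have [_ /(_ t)->] := gP s.
- have [s [uxy tst]] := cu _ _ _ cyx; have [t' [cyx' sts]] := uc _ _ _ uxy.
  have [_ ?] := arrow_fun cyx cyx'; subst t'.
  by apply/bE; exists s; split=> //; have [_ /(_ t)->] := gP s.
Qed.

Context {x : lam} {e : S -> spinj lam n S}.
Context (eE : forall s a c t,
  arrow (e s) a c t <-> [/\ a = x, c = x & t = s]).

Lemma loop_arrow s : arrow (e s) x x s.
Proof. by apply/eE. Qed.

Lemma loop_inj s t : e s = e t -> s = t.
Proof. by move=> est; have := loop_arrow s; rewrite est => /eE[]. Qed.

Lemma loopM s t : e s * e t = e (s * t).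
Proof.
apply: arrow_ext => a c r; split=> [|/eE[-> -> ->]].
  by move=> /arrowM[d [s' [t' [/eE[-> _ ->] /eE[_ -> ->] ->]]]]; apply/eE.
exact: arrowM_intro (loop_arrow s) (loop_arrow t).
Qed.

Lemma regular_labels : regular (spinj lam n S) -> regular S.
Proof.
move=> Ireg a; have [b /esym/inner_inverseP ab] := Ireg (e a).
by have [t [_ ata]] := ab _ _ _ (loop_arrow a); exists t.
Qed.

Lemma orthodox_labels : orthodox (spinj lam n S) -> orthodox S.
Proof.
move=> [Ireg Iidem]; split; first exact: regular_labels.
have eI s : idempotents s -> idempotents (e s).
  by rewrite /idempotents /= loopM => ->.
move=> s t /eI ss /eI tt; have := Iidem _ _ ss tt.
by rewrite /idempotents /= !loopM => /loop_inj.
Qed.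

(** An inverse of a loop is again a loop at the same point, so the inverses of
    [a] correspond to those of the loop labelled [a]. *)
Lemma inverse_labels :
  inverse_semigroup (spinj lam n S) -> inverse_semigroup S.
Proof.
move=> Iinv a; have [b [[/inner_inverseP ab /inner_inverseP ba] b_uniq]] :=
  Iinv (e a).
have [t [bt ata]] := ab _ _ _ (loop_arrow a).
have [s [/eE[_ _ ?] tat]] := ba _ _ _ bt; subst s.
exists t; split=> // t' [at'a t'at'].
have be : b = e t' by apply: b_uniq; rewrite !loopM at'a t'at'.
by move: bt; rewrite be => /eE[].
Qed.

End Transfer.

Theorem proposition3p5 (S : semigroupType) (lam : Type) (n : nat)
    (lam_neq0 : [set: lam] !=set0) (n_gt0 : (0 < n)%N)
    (n_le_lam : `I_n #<= [set: lam]) :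
  [/\ regular (spinj lam n S) <-> regular S,
      orthodox (spinj lam n S) <-> orthodox S
    & inverse_semigroup (spinj lam n S) <-> inverse_semigroup S].
Proof.
have [x _] := lam_neq0; have [e eE] := @loop_exists lam n S x n_gt0.
split; split.
- exact: regular_labels eE.
- exact: regular_extension.
- exact: orthodox_labels eE.
- exact: orthodox_extension.
- exact: inverse_labels eE.
- exact: inverse_extension.
Qed.
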